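(* If a locally convex space $E$ (with its original topology) is Eberlein-Grothendieck, then $(E,w)$ is also Eberlein-Grothendieck.
   Context: All topological spaces are assumed to be Tychonoff (in particular locally convex spaces are Hausdorff) and all vector spaces are over $\mathbb{R}$. For a locally convex space $E$, $(E,w)$ denotes $E$ with its weak topology $w=\sigma(E,E^{\ast})$, where $E^{\ast}$ is the space of continuous linear functionals on $E$. $C_p(K)$ is the space of continuous real-valued functions on $K$ with the topology of pointwise convergence. A topological space $Y$ is Eberlein-Grothendieck if there is a homeomorphic (not necessarily linear) embedding of $Y$ into $C_p(K)$ for some compact space $K$. *)

(* Defs.v *)
From HB Require Import structures.
From mathcomp Require Import all_boot all_order all_algebra.
From mathcomp Require Import all_classical all_reals all_analysis.

Set Implicit Arguments.
Unset Strict Implicit.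
Unset Printing Implicit Defensive.

Import Order.TTheory GRing.Theory Num.Theory.
Import numFieldNormedType.Exports.

Local Open Scope classical_set_scope.
Local Open Scope ring_scope.

(* This is the topology that [ArrowAsProduct] puts on [continuousType K R]; it
   is spelled out so as not to import those instances on arrow types. *)
Definition Cp (R : realType) (K : topologicalType) : topologicalType :=
  initial_topology (fun f : continuousType K R => (f : {ptws K -> R})).

Definition homeomorphic_embedding (Y Z : topologicalType) (f : Y -> Z) : Prop :=
  [/\ injective f, continuous f &
      forall A : set Y, open A -> exists2 B : set Z, open B &
        f @` A = B `&` range f].

(* [K] is Hausdorff because every space is assumed to be Tychonoff. *)
Definition Eberlein_Grothendieck (R : realType) (Y : topologicalType) : Prop :=
  exists K : topologicalType,
    [/\ compact [set: K], hausdorff_space K &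
        exists f : Y -> Cp R K, homeomorphic_embedding f].

Definition continuous_dual (R : realType) (E : tvsType R) : Type :=
  {l : {scalar E} | continuous (l : E -> R)}.

(* [E] with the coarsest topology that makes every [l] in the continuous dual
   continuous. *)
Definition weak_space (R : realType) (E : tvsType R) : topologicalType :=
  sup_topology (fun l : continuous_dual E =>
    Topological.class (initial_topology (sval l : E -> R))).

(* Main.v *)
From HB Require Import structures.
Require Import Defs.
From mathcomp Require Import all_boot all_order all_algebra.
From mathcomp Require Import all_classical all_reals all_analysis.
From mathcomp Require Import lra.

(** Let [f] embed [E] in [Cp R K] with [K] compact, and write [e x k] for
    [f x k]. Up to the topology, the claim is that the dual of [E] is
    sigma-compact for pointwise convergence; a countable union of compact sets
    of functions can then be squeezed into a single one.

    A neighbourhood of [0] in [E] contains one of the sets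
    [probe_nbhs F = {x | forall i < n, |e x (F i) - e 0 (F i)| < 1 / (n + 1)}]
    with [F : 'I_n -> K]. Let [P_n] be the set of linear functionals that are
    bounded by [1] on [probe_nbhs F] for some [F : 'I_n -> K]
    ([controlled e n]). Then:
    - every continuous functional lies in some [P_n] ([dual_controlled]), and
      conversely the elements of [P_n] are continuous ([controlled_dual]);
    - [P_n] is compact for pointwise convergence ([controlled_ultralimit]).
      Along an ultrafilter of functionals [l], the witnesses [F] converge in
      the compact space [K^n] to some [F'], and since [e x] is continuous on
      [K], a point of [probe_nbhs F'] eventually belongs to [probe_nbhs F]. As
      [probe_nbhs F'] is a neighbourhood of [0], it absorbs every [x], which
      bounds the values [l x] and makes them converge; the limit is linear and
      is bounded by [1] on [probe_nbhs F'].

    The sets of functions [{atan \o l / (n + 1) | l in P_n}] shrink uniformly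
    to [0], a function that already belongs to them, so that their union
    [squashed_dual e] is compact ([compact_squashed]). As [atan] is a
    homeomorphism onto its image, evaluation at the points of
    [squashed_dual e] induces exactly the weak topology, and it is the desired
    embedding as soon as it is injective, that is as soon as the dual of [E]
    separates points. This last fact is the Hahn-Banach theorem for Hausdorff
    locally convex spaces ([dual_separates]). It is obtained from minimal
    sublinear functionals, which are linear ([hahn_banach_dominated]), applied
    to the gauge of a convex neighbourhood of [0] ([gauge_functional]). *)

Set Implicit Arguments.
Unset Strict Implicit.
Unset Printing Implicit Defensive.

Import Order.TTheory GRing.Theory Num.Theory.
Import numFieldNormedType.Exports.

Local Open Scope classical_set_scope.
Local Open Scope ring_scope.

(** * Sublinear functionals and dominated linear functionals *)

Definition sublinear (R : realType) (E : lmodType R) (p : E -> R) : Prop :=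
  (forall x y, p (x + y) <= p x + p y) /\
  (forall t x, 0 < t -> p (t *: x) = t * p x).

Section Sublinear.
Context (R : realType) (E : lmodType R).
Implicit Types p q : E -> R.

Lemma sublinear0 p : sublinear p -> p 0 = 0.
Proof. by move=> [_ pZ]; have := pZ 2 0 (ltr0n _ 2); rewrite scaler0; lra. Qed.

Lemma sublinear_opp p x : sublinear p -> - p (- x) <= p x.
Proof.
by move=> sp; have := sp.1 x (- x); rewrite subrr (sublinear0 sp); lra.
Qed.

(** The common source of the sublinear functionals below: the gauge, the tilt
    of a sublinear functional, and the infimum of a chain are all infima of
    sets of reals that are compatible with sums and dilations in this sense. *)
Lemma sublinear_inf (A : E -> set R) :
  (forall x, has_inf (A x)) ->
  (forall x y a b, A x a -> A y b -> exists2 c, A (x + y) c & c <= a + b) ->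
  (forall t x a, 0 < t -> A x a -> exists2 c, A (t *: x) c & c <= t * a) ->
  sublinear (fun x => inf (A x)).
Proof.
move=> infA addA scaleA.
have scale_le t x : 0 < t -> inf (A (t *: x)) <= t * inf (A x).
  move=> t0; rewrite -ler_pdivrMl//; apply: lb_le_inf; first exact: (infA x).1.
  move=> a /(scaleA t _ _ t0)[c Ac ca]; rewrite ler_pdivrMl//.
  by apply: le_trans ca; apply: ge_inf Ac; exact: (infA _).2.
split=> [x y|t x t0].
  apply/ler_addgt0Pr => e e0; have e20 : 0 < e / 2 by rewrite divr_gt0.
  have [a Aa ae] := inf_adherent e20 (infA x).
  have [b Ab be] := inf_adherent e20 (infA y).
  have [c Ac cab] := addA _ _ _ _ Aa Ab.
  have := ge_inf (infA (x + y)).2 Ac; lra.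
apply/eqP; rewrite eq_le scale_le//= -ler_pdivlMl//.
have {1}-> : x = t^-1 *: (t *: x) by rewrite scalerA mulVf ?scale1r ?gt_eqF.
by rewrite scale_le ?invr_gt0.
Qed.

(** The witness is [x |-> inf_(t >= 0) q (x + t *: z) - t * q z]; the two bounds
    are the cases [t = 0] and [t = 1]. When [q] is minimal the tilt is [q]
    itself, and the second bound gives [q x + q z <= q (x + z)]. *)
Lemma sublinear_tilt q z : sublinear q ->
  exists q', [/\ sublinear q', forall x, q' x <= q x
    & forall x, q' x <= q (x + z) - q z].
Proof.
move=> sq; pose A x := [set q (x + t *: z) - t * q z | t in [set t | 0 <= t]].
have infA x : has_inf (A x).
  split; first by exists (q (x + 0 *: z) - 0 * q z); exists 0 => //=.
  exists (- q (- x)) => _ [t /= t0 <-].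
  have := sq.1 (x + t *: z) (- x).
  rewrite addrC addKr; have [->|tn0] := eqVneq t 0.
    by rewrite scale0r (sublinear0 sq); lra.
  by rewrite sq.2 ?lt_neqAle 1?eq_sym ?tn0//; lra.
have tiltP x t : 0 <= t -> inf (A x) <= q (x + t *: z) - t * q z.
  by move=> t0; apply: ge_inf; [exact: (infA x).2|exists t].
exists (fun x => inf (A x)); split=> [|x|x].
- apply: sublinear_inf => //.
  + move=> x y _ _ [s /= s0 <-] [t /= t0 <-].
    exists (q (x + y + (s + t) *: z) - (s + t) * q z).
      by exists (s + t) => //=; rewrite addr_ge0.
    by have := sq.1 (x + s *: z) (y + t *: z); rewrite scalerDl addrACA; lra.
  + move=> t x _ t0 [s /= s0 <-].
    exists (q (t *: x + (t * s) *: z) - (t * s) * q z).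
      by exists (t * s) => //=; rewrite mulr_ge0// ltW.
    by rewrite -scalerA -scalerDr sq.2//; lra.
- by have := tiltP x 0 (lexx _); rewrite scale0r addr0; lra.
- by have := tiltP x 1 ler01; rewrite scale1r mul1r.
Qed.

(** Zorn's lemma for the reverse pointwise order: since [- q (- x) <= q x], a
    chain below [p] is bounded below by [x |-> - p (- x)], so it has a pointwise
    infimum. *)
Lemma minimal_sublinear p : sublinear p ->
  exists q, [/\ sublinear q, forall x, q x <= p x
    & forall q', sublinear q' -> (forall x, q' x <= q x) ->
        forall x, q x <= q' x].
Proof.
move=> sp; pose T := {q : E -> R | sublinear q /\ forall x, q x <= p x}.
pose below (s t : T) := `[< forall x, sval t x <= sval s x >].
pose p0 : T := exist _ p (conj sp (fun x => lexx (p x))).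
have [||C Ctot|q qmin] := @ZL_preorder T p0 below.
- by move=> t; apply/asboolP => x; exact: lexx.
- move=> r s t /asboolP rs /asboolP st; apply/asboolP => x.
  exact: le_trans (st x) (rs x).
- have [[s0 Cs0]|C0] := pselect (exists s, C s); last first.
    by exists p0 => s Cs; case: C0; exists s.
  pose A x := [set sval s x | s in C].
  have infA x : has_inf (A x).
    split; first by exists (sval s0 x), s0.
    exists (- p (- x)) => _ [s Cs <-].
    have [ss sle] := svalP s; have := sublinear_opp x ss.
    by have := sle (- x); lra.
  have infP x s : C s -> inf (A x) <= sval s x.
    by move=> Cs; apply: ge_inf; [exact: (infA x).2|exists s].
  have sinf : sublinear (fun x => inf (A x)).
    apply: sublinear_inf => //.
    + move=> x y _ _ [s Cs <-] [t Ct <-].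
      have [/asboolP st|/asboolP ts] := Ctot _ _ Cs Ct.
      * exists (sval t (x + y)); first by exists t.
        by have := (svalP t).1.1 x y; have := st x; lra.
      * exists (sval s (x + y)); first by exists s.
        by have := (svalP s).1.1 x y; have := ts y; lra.
    + move=> t x _ t0 [s Cs <-]; exists (sval s (t *: x)); first by exists s.
      by rewrite (svalP s).1.2.
  have infp x : inf (A x) <= p x.
    exact: le_trans (infP x s0 Cs0) ((svalP s0).2 x).
  pose q0 : T := exist _ (fun x => inf (A x)) (conj sinf infp).
  exists q0 => s Cs; apply/asboolP => x /=.
  exact: infP.
have [sq qp] := svalP q; exists (sval q); split=> // q' sq' q'q.
have q'p x : q' x <= p x by exact: le_trans (q'q x) (qp x).
pose q1 : T := exist _ q' (conj sq' q'p).
by have /asboolP := qmin q1 (asboolT q'q).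
Qed.

(** A sublinear functional that is minimal is additive, by tilting it in every
    direction, hence linear. Minimality is taken below the tilt of [p] by [z],
    whose value at [- z] is at most [- p z]: this forces [p z <= l z]. *)
Lemma hahn_banach_dominated p z : sublinear p ->
  exists l : E -> R, [/\ scalar l, forall x, l x <= p x & p z <= l z].
Proof.
move=> sp; have [p' [sp' p'p p'z]] := sublinear_tilt z sp.
have [l [sl lp' lmin]] := minimal_sublinear sp'.
have lD x y : l (x + y) = l x + l y.
  apply/eqP; rewrite eq_le sl.1/=.
  have [l' [sl' l'l l'x]] := sublinear_tilt y sl.
  by have := lmin _ sl' l'l x; have := l'x x; lra.
have lN x : l (- x) = - l x.
  by have := lD x (- x); rewrite subrr (sublinear0 sl); lra.
have lZ t x : l (t *: x) = t * l x.
  have [t0|t0|<-] := ltrgtP 0 t; first exact: sl.2.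
    rewrite -[t]opprK scaleNr lN sl.2 ?oppr_gt0//; lra.
  by rewrite scale0r mul0r (sublinear0 sl).
exists l; split=> [a x y|x|]; first by rewrite lD lZ.
  exact: le_trans (lp' x) (p'p x).
have := p'z (- z); have := lp' (- z).
by rewrite lN addNr (sublinear0 sp); lra.
Qed.

End Sublinear.

(** * Continuous functionals on a locally convex space *)

Section ContinuousFunctionals.
Context (R : realType) (E : tvsType R).

Lemma continuous_affine (c : R) (x : E) :
  continuous (fun y : E => c *: (y - x)).
Proof.
move=> y; apply: (@continuous_comp _ _ _ (fun y => (c, y - x))
  (fun z : R^o * E => z.1 *: z.2)); last exact: scale_continuous.
apply: (@cvg_pair _ _ _ _ (nbhs (c : R^o))); first exact: cvg_cst.
apply: (@continuous_comp _ _ _ (fun y => (y, - x))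
  (fun z : E * E => z.1 + z.2)).
  by apply: cvg_pair => /=; [exact: cvg_id|exact: cvg_cst].
exact: add_continuous.
Qed.

Lemma scalar_continuous (l : E -> R) : scalar l ->
  (\forall x \near (0 : E), `|l x| <= 1) -> continuous l.
Proof.
move=> linl l1 x; apply/cvgrPdist_lt => e e0.
have := @continuous_affine (2 / e) x x.
rewrite /continuous_at subrr scaler0 => /(_ _ l1) nearx.
apply: (@filterS E (nbhs x) _ _ _ _ nearx) => y /=.
pose ll : {scalar E} := HB.pack l (GRing.isLinear.Build R E R *%R l linl).
have -> : l ((2 / e) *: (y - x)) = 2 / e * (l y - l x).
  by rewrite -[l]/(ll : E -> R) -linearB [LHS]linearZ.
rewrite normrM gtr0_norm ?divr_gt0//.
rewrite mulrAC ler_pdivrMr// mul1r distrC; lra.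
Qed.

Lemma continuous_dual_of_scalar (l : E -> R) : scalar l ->
  (\forall x \near (0 : E), `|l x| <= 1) ->
  exists f : continuous_dual E, (sval f : E -> R) = l.
Proof.
move=> linl l1.
pose ll : {scalar E} := HB.pack l (GRing.isLinear.Build R E R *%R l linl).
by exists (exist _ ll (scalar_continuous linl l1)).
Qed.

Lemma nbhs0_absorbing (U : set E) (x : E) : nbhs 0 U ->
  exists m : nat, U (m.+1%:R^-1 *: x).
Proof.
move=> U0.
have : (fun c : R^o => c *: x) @ 0 --> (0 : E).
  rewrite -[X in _ --> X](scale0r x).
  apply: (@continuous_comp _ _ _ (fun c : R^o => (c, x))
    (fun z : R^o * E => z.1 *: z.2)); last exact: scale_continuous.
  by apply: (@cvg_pair _ _ _ _ (nbhs (0 : R^o)));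
    [exact: cvg_id|exact: cvg_cst].
move=> /(_ U U0) /= c0.
have /(_ _ c0)[m _ mU] := @cvg_harmonic R.
by exists m; apply: (mU m) => /=.
Qed.

Lemma convex_nbhs0 (U : set E) : nbhs 0 U ->
  exists V : set E, [/\ nbhs 0 V, V `<=` U &
    forall x y (s t : R), 0 <= s -> 0 <= t -> s + t = 1 ->
      V x -> V y -> V (s *: x + t *: y)].
Proof.
move=> U0; have [B Bconvex [Bopen Bnbhs]] := @locally_convex R E.
have [V [BV V0] VU] := Bnbhs 0 U U0.
exists V; split=> //; first by apply: open_nbhs_nbhs; split=> //; exact: Bopen.
move=> x y s t s0 t0 st Vx Vy.
have s1 : s <= 1 by lra.
have := Bconvex V (mem_set BV) x y (Itv01 s0 s1) (mem_set Vx) (mem_set Vy).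
by rewrite inE (_ : t = 1 - s); last lra.
Qed.

(** The gauge of a convex neighbourhood [V] of [0] contained in [U]. If
    [z / t] were in [V] with [t < 1], then so would [z], a convex combination
    of [z / t] and [0]; hence the value at [z] is at least [1]. *)
Lemma gauge_functional (U : set E) (z : E) : nbhs 0 U -> ~ U z ->
  exists p : E -> R,
    [/\ sublinear p, \forall x \near 0, p x <= 1 & 1 <= p z].
Proof.
move=> /convex_nbhs0[V [V0 VU Vconvex]] Uz.
pose A (x : E) := [set t : R | 0 < t /\ V (t^-1 *: x)].
have infA x : has_inf (A x).
  split; last by exists 0 => t [/ltW].
  have [m Vm] := nbhs0_absorbing x V0.
  by exists m.+1%:R; split; rewrite ?ltr0n.
exists (fun x => inf (A x)); split.
- apply: sublinear_inf => //.
  + move=> x y s t [s0 Vs] [t0 Vt]; exists (s + t) => //.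
    split; first exact: addr_gt0.
    have st0 : s + t != 0 by rewrite gt_eqF// addr_gt0.
    have := Vconvex _ _ (s / (s + t)) (t / (s + t)) _ _ _ Vs Vt.
    rewrite !scalerA mulrAC divff ?gt_eqF// mulrAC divff ?gt_eqF// !mul1r.
    rewrite -scalerDr; apply.
    * by rewrite ltW// divr_gt0// addr_gt0.
    * by rewrite ltW// divr_gt0// addr_gt0.
    * by rewrite -mulrDl divff.
  + move=> t x a t0 [a0 Va]; exists (t * a) => //; split; first exact: mulr_gt0.
    by rewrite scalerA invfM mulrAC mulVf ?mul1r// gt_eqF.
- apply: filterS V0 => x Vx; apply: ge_inf; first exact: (infA x).2.
  by split; rewrite ?invr1 ?scale1r.
- apply: lb_le_inf; first exact: (infA z).1.
  move=> t [t0 Vt]; rewrite leNgt; apply/negP => t1; apply: Uz; apply: VU.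
  have := Vconvex _ _ t (1 - t) (ltW t0) _ _ Vt (nbhs_singleton V0).
  rewrite scalerA divff ?gt_eqF// scale1r scaler0 addr0; apply; lra.
Qed.

(** A functional dominated by a gauge is bounded by [1] on the symmetric
    neighbourhood where the gauge is at most [1] at both [x] and [- x], and is
    therefore continuous. *)
Lemma dual_separates (z : E) : hausdorff_space E -> z != 0 ->
  exists l : continuous_dual E, sval l z != 0.
Proof.
move=> hE z0.
have [U U0 Uz] : exists2 U : set E, nbhs 0 U & ~ U z.
  apply: contrapT => noU; move/eqP: z0; apply; apply/esym/hE => A B A0 Bz.
  exists z; split; last exact: nbhs_singleton.
  by apply: contrapT => Az; apply: noU; exists A.
have [p [sp p1 pz]] := gauge_functional U0 Uz.
have [l [linl lp lz]] := hahn_banach_dominated z sp.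
pose ll : {scalar E} := HB.pack l (GRing.isLinear.Build R E R *%R l linl).
have l1 : \forall x \near (0 : E), `|l x| <= 1.
  have := nbhs0N p1 => pN1; near=> x.
  have px : p x <= 1 by near: x.
  have pNx : p (- x) <= 1.
    suff [y /= py <-] : (-%R @` [set y | p y <= 1]) x by rewrite opprK.
    by near: x.
  have lN : l (- x) = - l x by rewrite -[l]/(ll : E -> R) linearN.
  by have := lp x; have := lp (- x); rewrite ler_norml lN; lra.
have [f fl] := continuous_dual_of_scalar linl l1.
by exists f; rewrite fl; apply/eqP => l0; move: lz; rewrite l0; lra.
Unshelve. all: by end_near. Qed.

End ContinuousFunctionals.

(** * Convergence of filters in the topologies involved *)

Lemma cvg_initial (S : choiceType) (T : topologicalType) (w : S -> T)
    (F : set_system S) (s : S) : Filter F ->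
  F --> (s : initial_topology w) <-> w @ F --> w s.
Proof.
move=> FF; split=> [Fs|Fs A [_ [[B oB <-] Bs BA]]].
  exact: (cvg_trans (cvg_app w Fs) (@initial_continuous S T w s)).
apply: (@filterS _ F _ _ _ BA); apply: (Fs B); exact: open_nbhs_nbhs.
Qed.

Lemma cvg_Cp (R : realType) (K : topologicalType) (F : set_system (Cp R K))
    (h : Cp R K) : Filter F ->
  F --> h <->
  forall k : K,
    (fun g : continuousType K R => g k) @ F --> (h : continuousType K R) k.
Proof.
move=> FF; rewrite cvg_initial; exact: pointwise_cvgP.
Qed.

Lemma cvg_weak (R : realType) (E : tvsType R) (F : set_system E) (x : E) :
  Filter F ->
  F --> (x : weak_space E) <->
  forall l : continuous_dual E, (sval l : E -> R) @ F --> (sval l : E -> R) x.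
Proof.
move=> FF; rewrite cvg_sup; split=> Fx l; have := Fx l; by rewrite cvg_initial.
Qed.

(** Convergence of filters turns the image condition on open sets into a
    statement that can be checked one coordinate at a time. *)
Lemma homeomorphic_embeddingP (Y Z : topologicalType) (f : Y -> Z) :
  injective f ->
  homeomorphic_embedding f <->
  forall (F : set_system Y) (y : Y), Filter F -> F --> y <-> f @ F --> f y.
Proof.
move=> finj; split=> [[_ fcont fopen] F y FF|fcvg].
  split=> [Fy|fF]; first exact: (cvg_trans (cvg_app f Fy) (fcont y)).
  move=> A; rewrite nbhsE => -[U [oU Uy] UA].
  have [B oB fUB] := fopen U oU.
  have Bfy : B (f y).
    by have [] : (B `&` range f) (f y) by rewrite -fUB; exists y.
  apply: (@filterS _ F _ _ _ UA); have := fF B (open_nbhs_nbhs (conj oB Bfy)).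
  apply: (@filterS _ F) => z /= Bfz.
  have [z' Uz' /finj <-//] : (f @` U) (f z).
  by rewrite fUB; split=> //; exists z.
split=> // [y|A oA]; first by apply/fcvg; exact: cvg_id.
(* [C] is the largest set whose preimage is contained in [A]. *)
pose C := [set z | forall y, f y = z -> A y].
exists (interior C); first exact: open_interior.
rewrite eqEsubset; split=> [_ [y Ay <-]|z [/interior_subset Cz [y _ yz]]];
  last by exists y => //; exact: Cz.
split; last by exists y.
(* The coarsest filter whose image converges to [f y]. *)
have FF : Filter (filter_from (nbhs (f y)) (fun B => f @^-1` B)).
  apply: filter_from_filter; first by exists setT; exact: filterT.
  by move=> B D yB yD; exists (B `&` D) => //; exact: filterI.
have fF : f @ filter_from (nbhs (f y)) (fun B => f @^-1` B) --> f y.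
  by move=> B yB; exists B.
have [B yB BA] := (fcvg _ y FF).2 fF A (open_nbhs_nbhs (conj oA Ay)).
apply: (@filterS _ (nbhs (f y)) _ _ _ _ yB) => z Bz y' fy'z; apply: BA.
by rewrite /= fy'z.
Qed.

Lemma ultra_cvg_compact (T : Type) (X : topologicalType) (G : set_system T)
    (f : T -> X) (A : set X) : UltraFilter G -> compact A ->
  (\forall t \near G, A (f t)) -> exists2 x, A x & f @ G --> x.
Proof.
move=> GU cA GA; have [x [Ax clx]] := cA (f @ G) _ GA; exists x => // B xB.
have [//|GnB] := in_ultra_setVsetC (f @^-1` B) GU.
by have [y []] := clx (~` B) B GnB xB.
Qed.

Definition no_probes {K : Type} (i : 'I_0) : K :=
  False_rect K (notF (ltn_ord i)).

(** * Functionals controlled by finitely many points of the compact space *)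

Section ControlledFunctionals.
Context (R : realType) (E : tvsType R) (K : topologicalType).
Variable e : E -> K -> R.

Definition probe_nbhs n (F : 'I_n -> K) : set E :=
  [set x | forall i, `|e x (F i) - e 0 (F i)| < n.+1%:R^-1].

(** The same [n] bounds the number of points and the precision, so that the
    functionals continuous at [0] are exhausted by countably many of these
    sets, with the points ranging over a compact power of [K]. *)
Definition controlled n (l : E -> R) : Prop :=
  scalar l /\
  exists F : 'I_n -> K, forall x, probe_nbhs F x -> `|l x| <= 1.

Hypothesis contE : forall k, continuous (e ^~ k).

Lemma nbhs_probe n (F : 'I_n -> K) : nbhs 0 (probe_nbhs F).
Proof.
apply: filter_forall => i.
have /cvgrPdist_lt/(_ n.+1%:R^-1) := @contE (F i) 0.
by rewrite invr_gt0 ltr0n => /(_ isT); apply: filterS => x; rewrite distrC.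
Qed.

Lemma controlled_dual n l : controlled n l ->
  exists f : continuous_dual E, (sval f : E -> R) = l.
Proof.
move=> [linl [F Fl]]; apply: continuous_dual_of_scalar => //.
exact: filterS (Fl) (nbhs_probe F).
Qed.

(** Compactness of the set of functionals controlled at level [n], in the form
    of the convergence of ultrafilters. The compactness of [K] gives a limit
    [Fo] of the witnesses; the functionals are then eventually bounded by [1]
    at each point of [probe_nbhs Fo], and so at every point up to a constant,
    because that neighbourhood is absorbing. *)
Lemma controlled_ultralimit (T : Type) (G : set_system T) (l : T -> E -> R) n :
  compact [set: K] -> (forall x, continuous (e x)) -> UltraFilter G ->
  (\forall t \near G, controlled n (l t)) ->
  exists2 p, controlled n p & forall x, l ^~ x @ G --> p x.
Proof.
move=> cK contK GU Gl.
have [t0 [_ [F0 _]]] := filter_ex Gl.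
have /choice[F FP] : forall t, exists F : 'I_n -> K,
    controlled n (l t) -> forall x, probe_nbhs F x -> `|l t x| <= 1.
  move=> t; have [[linl [F Fl]]|nc] := pselect (controlled n (l t)).
    by exists F.
  by exists F0.
have /choice[Fo FoP] : forall i : 'I_n, exists k : K,
    (fun t => F t i) @ G --> k.
  move=> i.
  have [|k _ Gk] := @ultra_cvg_compact _ _ _ (fun t => F t i) _ GU cK.
    exact: nearW.
  by exists k.
(* [probe_nbhs] is given by strict inequalities between continuous functions of
   the points, so it passes from the limit [Fo] to nearby [F t]. *)
have Gprobe x : probe_nbhs Fo x -> \forall t \near G, `|l t x| <= 1.
  move=> Fox; have : \forall t \near G, probe_nbhs (F t) x.
    apply: filter_forall => i.
    have cvgi : (fun t => `|e x (F t i) - e 0 (F t i)|) @ G -->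
        `|e x (Fo i) - e 0 (Fo i)|.
      apply: cvg_norm; apply: cvgB.
        exact: (cvg_comp _ _ (FoP i) (@contK x (Fo i))).
      exact: (cvg_comp _ _ (FoP i) (@contK 0 (Fo i))).
    exact: (cvgr_lt _ cvgi _ (Fox i)).
  by apply: filterS2 Gl => t ct; exact: FP.
have limE a u v : \forall t \near G, l t (a *: u + v) = a * l t u + l t v.
  by apply: filterS Gl => t [linl _]; exact: linl.
have /choice[p pP] : forall x, exists r : R, l ^~ x @ G --> r.
  move=> x; have [m Fom] := nbhs0_absorbing x (nbhs_probe Fo).
  have Gx : \forall t \near G, l t x \in `[- m.+1%:R, m.+1%:R]%R.
    apply: filterS2 Gl (Gprobe _ Fom) => t [linl _].
    have /= -> : l t (m.+1%:R^-1 *: x) = m.+1%:R^-1 * l t x.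
      pose ll : {scalar E} :=
        HB.pack (l t) (GRing.isLinear.Build R E R *%R _ linl).
      by rewrite -[l t]/(ll : E -> R) [LHS]linearZ.
    rewrite normrM gtr0_norm ?invr_gt0 ?ltr0n// ler_pdivrMl ?ltr0n// mulr1.
    by rewrite ler_norml in_itv.
  have [r _ Gr] := ultra_cvg_compact GU (@segment_compact R _ _) Gx.
  by exists r.
exists p => //; split.
  move=> a u v.
  apply: (@cvg_unique _ (@Rhausdorff R) _ _ _ _ (pP (a *: u + v))).
  have : (fun t => a * l t u + l t v) @ G --> a * p u + p v.
    by apply: cvgD => //; apply: cvgM => //; exact: cvg_cst.
  by apply: cvg_trans; apply: near_eq_cvg; apply: filterS (limE a u v) => t.
exists Fo => x Fox; exact: cvgr_to_le (cvg_norm (pP x)) (Gprobe x Fox).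
Qed.

End ControlledFunctionals.

(** * The compact space of squashed functionals *)

Section CompactifiedDual.
Context (R : realType) (E : tvsType R) (K : topologicalType).
Variable e : E -> K -> R.
Hypotheses (cK : compact [set: K]) (contE : forall k, continuous (e ^~ k))
  (contK : forall x, continuous (e x)).

(** Composition with [atan] keeps all the information carried by a functional
    while making it bounded, and the factor [1 / (n + 1)] makes the functions
    of level [n] tend uniformly to [0]. *)
Definition squashed_dual : set {ptws E -> R} :=
  [set g | exists n, exists2 l : E -> R, controlled e n l &
    g = (fun x => n.+1%:R^-1 * atan (l x))].

Local Notation Q := (set_type squashed_dual).

Lemma cvg_squashed (G : set_system Q) (q : Q) : Filter G ->
  G --> q <-> forall x, (fun g : Q => set_val g x) @ G --> set_val q x.
Proof.
move=> GF; rewrite (@cvg_initial _ _ (@set_val _ squashed_dual)).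
exact: pointwise_cvgP.
Qed.

Lemma hausdorff_squashed : hausdorff_space Q.
Proof.
move=> q r; rewrite cluster_cvgE => -[G GF [Gr Gq]].
apply/val_inj/funext => x.
exact: (@cvg_unique _ (@Rhausdorff R) _ _ _ _
  ((cvg_squashed q _).1 Gq x) ((cvg_squashed r _).1 Gr x)).
Qed.

Lemma norm_atan_le (t : R) : `|atan t| <= pi / 2.
Proof. by rewrite ler_norml (ltW (atan_gtNpi2 t)) (ltW (atan_ltpi2 t)). Qed.

Lemma controlled0 : controlled e 0 (fun=> 0).
Proof.
split; first by move=> a x y; rewrite mulr0 addr0.
exists (@no_probes K).
by move=> x _; rewrite normr0.
Qed.

(** An ultrafilter either lives on a single level [n], where the controlled
    functionals form a compact set, or leaves every level, and then it
    converges to the function [0]. *)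
Lemma compact_squashed : compact [set: Q].
Proof.
rewrite compact_ultra => G GU _.
have /choice[n /choice[l nlP]] : forall q : Q, exists n, exists l : E -> R,
    controlled e n l /\ set_val q = (fun x => n.+1%:R^-1 * atan (l x)).
  by move=> q; have [n [l cl ql]] := set_valP q; exists n, l.
have [[N GN]|Gn] := pselect (exists N, \forall q \near G, n q = N).
  have [|p cp pP] := @controlled_ultralimit R E K e contE Q G l N cK contK GU.
    by apply: filterS GN => q <-; exact: (nlP q).1.
  have sp : squashed_dual (fun x => N.+1%:R^-1 * atan (p x)) by exists N, p.
  exists (SigSub (mem_set sp)); split=> //=; apply/cvg_squashed => x /=.
  have : (fun q => N.+1%:R^-1 * atan (l q x)) @ G --> N.+1%:R^-1 * atan (p x).
    apply: cvgM; first exact: cvg_cst.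
    exact: (cvg_comp _ _ (pP x) (@continuous_atan R (p x))).
  apply: cvg_trans; apply: near_eq_cvg; apply: filterS GN => q qN.
  by rewrite (nlP q).2 qN.
have Gge N : \forall q \near G, (N <= n q)%N.
  elim: N => [|N IH]; first exact: nearW.
  have [GN|GN] := in_ultra_setVsetC [set q | n q = N] GU.
    by case: Gn; exists N.
  apply: filterS2 IH GN => q; rewrite leq_eqVlt => /predU1P[->|//].
  by move=> /(_ erefl).
have s0 : squashed_dual (fun=> 0).
  exists 0%N, (fun=> 0); first exact: controlled0.
  by apply/funext => x; rewrite atan0 mulr0.
exists (SigSub (mem_set s0)); split=> //=; apply/cvg_squashed => x /=.
apply/cvgrPdist_lt => eps eps0.
have pe0 : 0 < eps / (pi / 2) by rewrite divr_gt0// divr_gt0// pi_gt0.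
have [N _ Neps] := near_infty_natSinv_lt (PosNum pe0).
apply: filterS (Gge N) => q qN; rewrite sub0r normrN (nlP q).2 normrM.
rewrite gtr0_norm ?invr_gt0 ?ltr0n//.
have := Neps (n q) qN; rewrite /= ltr_pdivlMr ?divr_gt0 ?pi_gt0//.
apply: le_lt_trans; apply: ler_wpM2l => //; exact: norm_atan_le.
Qed.

End CompactifiedDual.

(** The sets [probe_nbhs e F] form a filter base converging to [0]: the points
    of two of them can be put side by side, and the precision improves with the
    number of points. So one of them is contained in [{x | |l x| < 1}]. *)
Lemma dual_controlled (R : realType) (E : tvsType R) (K : topologicalType)
    (e : E -> K -> R) :
  (forall F : set_system E, Filter F ->
    (forall k, e ^~ k @ F --> e 0 k) -> F --> (0 : E)) ->
  forall l : continuous_dual E, exists n, controlled e n (sval l).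
Proof.
move=> initE l.
pose D := filter_from [set: {n & 'I_n -> K}] (fun s => probe_nbhs e (projT2 s)).
have DF : Filter D.
  apply: filter_fromT_filter.
    by exists (existT (fun n => 'I_n -> K) 0%N (@no_probes K)).
  move=> [m F] [n F'] /=.
  exists (existT (fun n => 'I_n -> K) (m + n)%N
    (fun i => match fintype.split i with
              | inl j => F j
              | inr j => F' j
              end)) => /=.
  have inv_le k : (k <= m + n)%N -> (m + n).+1%:R^-1 <= k.+1%:R^-1 :> R.
    by move=> kmn; rewrite lef_pV2 ?posrE ?ltr0n// ler_nat ltnS.
  move=> x xF; split=> i.
    have := xF (unsplit (inl i)); rewrite unsplitK => /lt_le_trans; apply.
    exact/inv_le/leq_addr.
  have := xF (unsplit (inr i)); rewrite unsplitK => /lt_le_trans; apply.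
  exact/inv_le/leq_addl.
have D0 : D --> (0 : E).
  apply: initE => k; apply/cvgrPdist_lt => eps eps0.
  have [N _ Neps] := near_infty_natSinv_lt (PosNum eps0).
  exists (existT (fun n => 'I_n -> K) N.+1 (fun=> k)) => // x /(_ ord0) /=.
  by rewrite distrC => /lt_trans; apply; exact: (Neps N.+1 (leqnSn N)).
have l0 : \forall x \near (0 : E), `|sval l x| < 1.
  have /cvgr0Pnorm_lt : sval l x @[x --> (0 : E)] --> (0 : R).
    by rewrite -[X in _ --> X](linear0 (sval l)); exact: (svalP l).
  by apply.
have [[n F] _ Fl] := D0 _ l0.
exists n; split; first exact: linearP.
by exists F => x /Fl/ltW.
Qed.

(** * Weak spaces of Eberlein-Grothendieck spaces *)

Theorem corollary2p2 (R : realType) (E : tvsType R)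
  (hE : hausdorff_space E)
  (EG : Eberlein_Grothendieck R E) :
  Eberlein_Grothendieck R (weak_space E).
Proof.
have [K [cK _ [f femb]]] := EG.
have [finj fcont _] := femb.
pose e (x : E) (k : K) : R := (f x : continuousType K R) k.
have contK x : continuous (e x) by exact: cts_fun.
have contE k : continuous (e ^~ k).
  move=> x; have := (cvg_Cp (f x) (nbhs_filter (f x))).1 (@cvg_id _ _) k.
  exact: cvg_comp (fcont x).
have initE (F : set_system E) : Filter F ->
    (forall k, e ^~ k @ F --> e 0 k) -> F --> (0 : E).
  move=> FF Fe; apply/(homeomorphic_embeddingP finj).1 => //.
  exact/cvg_Cp.
exists (set_type (squashed_dual e)); split.
- exact: compact_squashed.
- exact: hausdorff_squashed.
have evalC (x : E) :
    continuous (fun q : set_type (squashed_dual e) => set_val q x).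
  by move=> q; exact: ((cvg_squashed q (nbhs_filter q)).1 (@cvg_id _ _) x).
pose g (x : weak_space E) : Cp R (set_type (squashed_dual e)) :=
  mkcts (evalC x).
exists g.
have squashE n (l : E -> R) (cl : controlled e n l) :
    exists q : set_type (squashed_dual e),
      forall x, set_val q x = n.+1%:R^-1 * atan (l x).
  have sl : squashed_dual e (fun x => n.+1%:R^-1 * atan (l x)).
    by exists n, l.
  by exists (SigSub (mem_set sl)).
apply/homeomorphic_embeddingP => [x y gxy|F x FF].
  apply/eqP; rewrite -subr_eq0; apply/negPn/negP => /(dual_separates hE)[l].
  have [n /squashE[q qE]] := dual_controlled initE l.
  have : set_val q x = set_val q y by rewrite -[LHS]/(g x q) gxy.
  rewrite !qE => /mulfI -/(_ _)/(can_inj (@atanK R)) => lxy.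
  by rewrite linearB/= lxy ?subrr ?eqxx// invr_eq0 pnatr_eq0.
rewrite cvg_weak cvg_Cp; split=> [Fl q|Fg l].
  have [n [l cl qE]] := set_valP q.
  have [l' l'E] := controlled_dual contE cl.
  have := Fl l'; rewrite l'E => {}Fl.
  have {}qE : (set_val q : E -> R) = (fun y => n.+1%:R^-1 * atan (l y)) := qE.
  suff : set_val q @ F --> set_val q x by [].
  rewrite qE.
  apply: cvgM; first exact: cvg_cst.
  exact: (cvg_comp _ _ Fl (@continuous_atan R (l x))).
have [n /squashE[q qE]] := dual_controlled initE l.
have n0 : n.+1%:R != 0 :> R by rewrite pnatr_eq0.
have Fatan : (fun y => atan (sval l y)) @ F --> atan (sval l x).
  have -> : (fun y => atan (sval l y)) = (fun y => n.+1%:R * set_val q y).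
    by apply/funext => y; rewrite qE mulVKf.
  rewrite -[atan _](mulVKf n0) -qE; apply: cvgM; first exact: cvg_cst.
  exact: (Fg q).
(* Undo [atan]: its values stay in the interval where [tan] is continuous. *)
have cosl : cos (atan (sval l x)) != 0.
  by rewrite gt_eqF// cos_gt0_pihalf// atan_gtNpi2 atan_ltpi2.
have := cvg_comp _ _ Fatan (continuous_tan cosl).
rewrite atanK; apply: cvg_trans; apply: near_eq_cvg; apply: nearW => y.
by rewrite /= atanK.
Qed.
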